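(* Assume the PRIS-ARIS-NOMA model described in the context. Let $R_{D_m}^{ergodic}(P_s^a)=\mathbb{E}\left[\log_2(1+\gamma_{D_m})\right]$ be the ergodic data rate of the distant user $D_m$ at transmit power $P_s^a$. Then, with all other parameters fixed, the ergodic data rate slope of $D_m$ is equal to zero, i.e. $$\lim_{P_s^a\to\infty}\frac{R_{D_m}^{ergodic}(P_s^a)}{\log_2P_s^a}=0.$$
   Context: Parameters: integers $M,N\ge 1$ (numbers of reflecting elements of the active RIS (ARIS) and the passive RIS (PRIS)); ARIS amplification factor $\beta>1$; transmit power $P_s^a>0$; power allocation factors $a_n,a_m>0$ with $a_n+a_m=1$; noise powers $\sigma_a^2,\sigma^2>0$; Rician factor $\kappa>0$; Nakagami shape parameter $m_{na}>0$ and scale parameter $\Omega_{na}>0$; path loss $\eta>0$, path loss exponent $\alpha>0$, distances $d_{h1},d_{h2},d_{g1},d_{gm}>0$; $\overline{\lambda_m}=\eta^{-4}d_{h1}^{\alpha}d_{h2}^{\alpha}d_{g1}^{\alpha}d_{gm}^{\alpha}$. Channel statistics (cascaded Rician and Nakagami-$m$ fading, approximate distributions): let $e_\varphi=\sqrt{\frac{\pi}{4(\kappa+1)}}\,\frac{\Gamma(m_{na}+\frac12)}{\Gamma(m_{na})}\,m_{na}^{-1/2}\,L_{1/2}(-\kappa)$ and $d_\varphi=1-\frac{L_{1/2}^2(-\kappa)}{4(\kappa+1)}\cdot\frac{\pi}{m_{na}}\left(\frac{\Gamma(m_{na}+\frac12)}{\Gamma(m_{na})}\right)^2$, where $L_{1/2}(-\kappa)=e^{-\kappa/2}\left[(1+\kappa)I_0(\kappa/2)+\kappa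 I_1(\kappa/2)\right]$ with $I_0,I_1$ modified Bessel functions of the first kind. Put $a_X=\frac{Ne_\varphi^2}{d_\varphi}-1$, $a_Y=\frac{Me_\varphi^2}{d_\varphi}-1$, $b_X=b_Y=\frac{d_\varphi}{e_\varphi}$. The cascaded channel gains $\zeta_h,\zeta_g$ are independent positive random variables with densities $f_{\zeta_h}(x)=\frac{x^{(a_X-1)/2}}{2b_X^{a_X+1}\Gamma(a_X+1)}e^{-\sqrt{x}/b_X}$ and $f_{\zeta_g}(y)=\frac{y^{(a_Y-1)/2}}{2b_Y^{a_Y+1}\Gamma(a_Y+1)}e^{-\sqrt{y}/b_Y}$ on $(0,\infty)$. SINR: with $W_m=\zeta_h\zeta_g/\overline{\lambda_m}$, $$\gamma_{D_m}=\frac{\beta P_s^aW_ma_m}{\beta P_s^aW_ma_n+\beta\sigma_a^2M\Omega_{na}+\sigma^2}.$$ *)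

(* Defs.v *)
From HB Require Import structures.
From mathcomp Require Import all_boot all_order all_algebra.
From mathcomp Require Import all_classical all_reals all_analysis.

Set Implicit Arguments.
Unset Strict Implicit.
Unset Printing Implicit Defensive.

Import Order.TTheory GRing.Theory Num.Theory.
Import numFieldNormedType.Exports.

Local Open Scope classical_set_scope.
Local Open Scope ring_scope.

Definition log2 {R : realType} (x : R) : R := ln x / ln 2.

(* Euler's integral, meaningful for z > 0. *)
Definition Gamma {R : realType} (z : R) : R :=
  \int[lebesgue_measure]_(t in `]0, +oo[) (t `^ (z - 1) * expR (- t)).

(* Modified Bessel function of the first kind I_nu of integer order nu;
   Gamma (k + nu + 1) in its power series is (k + nu)!. *)
Definition besselI {R : realType} (nu : nat) (x : R) : R :=
  limn (series (fun k : nat =>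
    (x / 2) ^+ (2 * k + nu)%N / ((k`! * (k + nu)`!)%N)%:R)).

(* L_{1/2}(- kappa), as a function of kappa. *)
Definition laguerre_half_opp {R : realType} (kappa : R) : R :=
  expR (- kappa / 2) *
  ((1 + kappa) * besselI 0 (kappa / 2) + kappa * besselI 1 (kappa / 2)).

Definition e_phi {R : realType} (kappa m_na : R) : R :=
  Num.sqrt (pi / (4 * (kappa + 1))) * (Gamma (m_na + 2^-1) / Gamma m_na)
  * m_na `^ (- 2^-1) * laguerre_half_opp kappa.

Definition d_phi {R : realType} (kappa m_na : R) : R :=
  1 - laguerre_half_opp kappa ^+ 2 / (4 * (kappa + 1)) * (pi / m_na)
      * (Gamma (m_na + 2^-1) / Gamma m_na) ^+ 2.

(* a_X is gain_a with n = N, and a_Y is gain_a with n = M. *)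
Definition gain_a {R : realType} (kappa m_na : R) (n : nat) : R :=
  n%:R * e_phi kappa m_na ^+ 2 / d_phi kappa m_na - 1.

Definition gain_b {R : realType} (kappa m_na : R) : R :=
  d_phi kappa m_na / e_phi kappa m_na.

(* The density on ]0, +oo[, extended by 0 to the whole line. *)
Definition gain_pdf {R : realType} (a b : R) : R -> R :=
  (fun x => x `^ ((a - 1) / 2) / (2 * b `^ (a + 1) * Gamma (a + 1))
            * expR (- (Num.sqrt x / b))) \_ `]0, +oo[.

Definition has_density {R : realType} {d : measure_display}
    {T : measurableType d} (P : probability T R) (X : {RV P >-> R})
    (f : R -> R) : Prop :=
  forall A : set R, measurable A ->
    distribution P X A = (\int[lebesgue_measure]_(x in A) (f x)%:E)%E.

Definition independent_RV2 {R : realType} {d : measure_display}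
    {T : measurableType d} (P : probability T R) (X Y : {RV P >-> R}) : Prop :=
  forall A B : set R, measurable A -> measurable B ->
    P (X @^-1` A `&` Y @^-1` B) = (P (X @^-1` A) * P (Y @^-1` B))%E.

Definition lambda_m {R : realType} (eta alpha d_h1 d_h2 d_g1 d_gm : R) : R :=
  eta ^- 4 * d_h1 `^ alpha * d_h2 `^ alpha * d_g1 `^ alpha * d_gm `^ alpha.

(* sigma2_a and sigma2 are the noise powers themselves (already squared), and
   W is the normalized gain zeta_h * zeta_g / lambda_m. *)
Definition sinr {R : realType} (M : nat)
    (beta a_n a_m sigma2_a sigma2 Omega_na Ps W : R) : R :=
  beta * Ps * W * a_m /
  (beta * Ps * W * a_n + beta * sigma2_a * M%:R * Omega_na + sigma2).

(* Kept in \bar R, so that no finiteness of the expectation is presupposed. *)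
Definition ergodic_rate {R : realType} {d : measure_display}
    {T : measurableType d} (P : probability T R) (zeta_h zeta_g : T -> R)
    (lambda : R) (M : nat)
    (beta a_n a_m sigma2_a sigma2 Omega_na Ps : R) : \bar R :=
  ('E_P[fun w => log2 (1 + sinr M beta a_n a_m sigma2_a sigma2 Omega_na Ps
                             (zeta_h w * zeta_g w / lambda))])%E.

(* Main.v *)
Require Import Defs.
From HB Require Import structures.
From mathcomp Require Import all_boot all_order all_algebra.
From mathcomp Require Import all_classical all_reals all_analysis.
From mathcomp Require Import measurable_realfun.
Import Order.TTheory GRing.Theory Num.Theory.
Import numFieldNormedType.Exports.
Local Open Scope classical_set_scope.
Local Open Scope ring_scope.

(** The interference term [beta * Ps * W * a_n] in the denominator bounds the SINR
    by [a_m / a_n] whatever the transmit power and the gain [W > 0]. Hence the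
    rate stays below [log2 (1 + a_m / a_n)] while [log2 Ps] diverges. *)

Section RealFunctions.
Context {R : realType}.

(** Inversion is continuous on the open set of nonzero reals, and every function is measurable on a
    singleton. This covers the points where the denominator of the SINR vanishes. *)
Lemma measurable_inv : measurable_fun [set: R] (@GRing.inv R).
Proof.
rewrite -(setUv [set 0 : R]); apply/measurable_funU => //.
  exact: measurableC.
split; first exact: measurable_fun_set1.
apply: open_continuous_measurable_fun.
  exact/closed_openC/closed_eq.
move=> x; rewrite inE /= => /eqP x0; exact: inv_continuous.
Qed.

Lemma ln2_gt0 : 0 < ln 2 :> R.
Proof. by rewrite ln_gt0// ltr1n. Qed.

Lemma measurable_log2 : measurable_fun [set: R] (@log2 R).
Proof. by apply: measurable_funM => //; exact: measurable_ln. Qed.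

Lemma log2_ge0 (x : R) : 1 <= x -> 0 <= log2 x.
Proof. by move=> x1; apply: divr_ge0; rewrite ln_ge0// ler1n. Qed.

Lemma ler_log2 (x y : R) : 0 < x -> x <= y -> log2 x <= log2 y.
Proof.
move=> x0 xy; rewrite ler_pM2r ?invr_gt0 ?ln2_gt0// ler_ln// posrE//.
exact: lt_le_trans xy.
Qed.

Lemma log2_cvgy : @log2 R x @[x --> +oo] --> +oo.
Proof.
apply/cvgryPge => A; near=> x.
(* The threshold is $2^A$, written in base $e$. *)
have Ax : expR (A * ln 2) < x by near: x; exact: nbhs_pinfty_gt.
have x0 : 0 < x by apply: lt_trans Ax; exact: expR_gt0.
by rewrite ler_pdivlMr ?ln2_gt0// -[leLHS]expRK ler_ln ?posrE ?expR_gt0// ltW.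
Unshelve. all: by end_near. Qed.

End RealFunctions.

Section BoundedExpectation.
Context {R : realType} {d : measure_display} {T : measurableType d}.
Variable P : probability T R.

(** A probability has total mass 1, so the constant [C] integrates to itself. The bound is asked
    only almost everywhere because the gains are positive only almost surely. *)
Lemma abse_expectation_le (X : T -> R) (C : R) :
  measurable_fun [set: T] X -> {ae P, forall w, `|X w| <= C} -> 0 <= C ->
  (`|'E_P[X]| <= C%:E)%E.
Proof.
move=> mX XC C0; rewrite unlock.
apply: le_trans (le_abse_integral _ _ _) _ => //.
  exact/measurable_EFinP.
rewrite -[leRHS]mule1 -(@probability_setT _ _ _ P) -integral_cst//.
apply: ae_ge0_le_integral => //=.
- by apply: measurableT_comp => //; apply: measurableT_comp.
- by apply: filterS XC => w XCw _; rewrite lee_fin.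
Qed.

End BoundedExpectation.

Lemma bounded_div_cvgy (R : realType) (f : R -> \bar R) (g : R -> R) (C : R) :
  (\forall x \near +oo, (`|f x| <= C%:E)%E) -> g x @[x --> +oo] --> +oo ->
  (f x / (g x)%:E)%E @[x --> +oo] --> 0%E.
Proof.
move=> fC gy.
have g_gt0 : \forall x \near +oo, 0 < g x by move/cvgryPgt : gy; apply.
(* Stated for any [k], to serve both sides of the squeeze between [- C / g] and [C / g]. *)
have Cg0 (k : R) : (k * (g x)^-1)%:E @[x --> +oo] --> 0%E.
  apply: cvg_EFin; first exact: nearW.
  rewrite -[X in _ --> X](mulr0 k); apply: cvgMr.
  exact/gtr0_cvgV0.
apply: squeeze_cvge (Cg0 (- C)) (Cg0 C).
near=> x.
have g0 : 0 < g x by near: x.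
have : (`|f x| <= C%:E)%E by near: x.
(* Infinite values contradict the bound; for a finite one, [g x != 0] turns the extended quotient
   into a real one. *)
case: (f x) => [r| |]; rewrite ?leye_eq//= inver gt_eqF// -EFinM !lee_fin.
by rewrite ler_norml => /andP[? ?]; rewrite !ler_pM2r ?invr_gt0//; apply/andP.
Unshelve. all: by end_near. Qed.

Section Sinr.
Context {R : realType}.
Variables (M : nat) (beta a_n a_m sigma2_a sigma2 Omega_na Ps : R).
Local Notation gamma := (sinr M beta a_n a_m sigma2_a sigma2 Omega_na Ps).

Lemma measurable_sinr : measurable_fun [set: R] gamma.
Proof.
have mPs : measurable_fun [set: R] (fun W => beta * Ps * W).
  exact: measurable_funM.
apply: measurable_funM; first exact: measurable_funM.
apply: measurableT_comp; first exact: measurable_inv.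
apply: measurable_funD => //; apply: measurable_funD => //.
exact: measurable_funM.
Qed.

Hypotheses (beta0 : 0 < beta) (a_n0 : 0 < a_n) (a_m0 : 0 <= a_m).
Hypotheses (sigma2_a0 : 0 <= sigma2_a) (sigma20 : 0 <= sigma2).
Hypotheses (Omega0 : 0 <= Omega_na) (Ps0 : 0 < Ps).

Lemma sinr_itv (W : R) : 0 < W -> 0 <= gamma W <= a_m / a_n.
Proof.
move=> W0; rewrite /sinr -addrA.
(* The SINR becomes [x * a_m / (x * a_n + c)], with [c] the total noise. *)
set x := beta * Ps * W; set c := _ + sigma2.
have x0 : 0 < x by rewrite !mulr_gt0.
have c0 : 0 <= c by rewrite addr_ge0// !mulr_ge0// ltW.
have D0 : 0 < x * a_n + c by rewrite ltr_pwDl// mulr_gt0.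
apply/andP; split; first by rewrite divr_ge0 ?mulr_ge0// ltW.
(* Cross-multiplied, the claim is [a_m * (x * a_n) <= a_m * (x * a_n + c)], which follows from
   [0 <= c]. *)
rewrite ler_pdivrMr// [leRHS]mulrAC ler_pdivlMr//.
by rewrite (mulrC x) -mulrA ler_wpM2l// lerDl.
Qed.

(** The bound involves neither [W] nor [Ps]: it survives the expectation and is uniform as the power
    grows. *)
Lemma log2_sinr_norm_le (W : R) :
  0 < W -> `|log2 (1 + gamma W)| <= log2 (1 + a_m / a_n).
Proof.
move=> /sinr_itv/andP[g0 ga].
rewrite ger0_norm ?log2_ge0 ?lerDl//.
by rewrite ler_log2 ?lerD2l// ltr_pwDl.
Qed.

End Sinr.

Theorem mainTheorem13 (R : realType) (d : measure_display)
    (T : measurableType d) (P : probability T R)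
    (M N : nat)
    (beta a_n a_m sigma2_a sigma2 kappa m_na Omega_na eta alpha
       d_h1 d_h2 d_g1 d_gm : R)
    (zeta_h zeta_g : {RV P >-> R})
    (hM : (1 <= M)%N) (hN : (1 <= N)%N)
    (hbeta : 1 < beta)
    (ha_n : 0 < a_n) (ha_m : 0 < a_m) (ha : a_n + a_m = 1)
    (hsigma2_a : 0 < sigma2_a) (hsigma2 : 0 < sigma2)
    (hkappa : 0 < kappa) (hm_na : 0 < m_na) (hOmega_na : 0 < Omega_na)
    (heta : 0 < eta) (halpha : 0 < alpha)
    (hd_h1 : 0 < d_h1) (hd_h2 : 0 < d_h2)
    (hd_g1 : 0 < d_g1) (hd_gm : 0 < d_gm)
    (hindep : independent_RV2 zeta_h zeta_g)
    (hpos_h : {ae P, forall w, 0 < zeta_h w})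
    (hpos_g : {ae P, forall w, 0 < zeta_g w})
    (hpdf_h : has_density zeta_h
                (gain_pdf (gain_a kappa m_na N) (gain_b kappa m_na)))
    (hpdf_g : has_density zeta_g
                (gain_pdf (gain_a kappa m_na M) (gain_b kappa m_na))) :
  (ergodic_rate P zeta_h zeta_g (lambda_m eta alpha d_h1 d_h2 d_g1 d_gm)
     M beta a_n a_m sigma2_a sigma2 Omega_na Ps / (log2 Ps)%:E)%E
    @[Ps --> +oo] --> 0%E.
Proof.
set lambda := lambda_m _ _ _ _ _ _.
have lambda0 : 0 < lambda.
  by rewrite /lambda /lambda_m !mulr_gt0 ?powR_gt0// invr_gt0 exprn_gt0.
have mW : measurable_fun [set: T] (fun w => zeta_h w * zeta_g w / lambda).
  by do 2 apply: measurable_funM => //.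
apply: (@bounded_div_cvgy _ _ _ (log2 (1 + a_m / a_n))); last exact: log2_cvgy.
near=> Ps.
(* Only large powers matter for the limit, so [Ps] may be taken positive. *)
have Ps0 : 0 < Ps by near: Ps; exact: nbhs_pinfty_gt.
apply: abse_expectation_le.
- apply: measurableT_comp; first exact: measurable_log2.
  apply: measurable_funD => //.
  exact: (measurableT_comp (measurable_sinr _ _ _ _ _ _ _ _) mW).
(* Both gains are positive on the intersection of two almost sure events, and there the normalized
   gain is positive. *)
- move: hpos_h hpos_g; apply: filterS2 => w h0 g0.
  have beta0 : 0 < beta by exact: lt_trans hbeta.
  by apply: log2_sinr_norm_le => //; rewrite ?ltW// divr_gt0// mulr_gt0.
- by rewrite log2_ge0// lerDl divr_ge0// ltW.
Unshelve. all: by end_near. Qed.
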